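(* There is a family $(P_d)_{d\in\mathbb{N}}$ of finite weighted point sets $P_d\subset\mathbb{R}^d$ (positive integer weights) such that, with $k=2^d$, the cost of the $k$-clustering computed by Ward's method on $P_d$ satisfies $\mathrm{Ward}_k(P_d)\in\Omega\big((3/2)^d\cdot\mathrm{opt}_k(P_d)\big)$.
   Context: For a finite point set $Q$ with weights $w$, $\mu(Q,w)=\frac{1}{w(Q)}\sum_{x\in Q}w(x)x$ with $w(Q)=\sum_{x\in Q}w(x)$, and $\Delta(Q,w)=\sum_{x\in Q}w(x)\|x-\mu(Q,w)\|^2$. For disjoint clusters $A,B$, $D(A,B)=\Delta(A\cup B,w)-\Delta(A,w)-\Delta(B,w)$. $\mathrm{opt}_k(P)=\min_{C\subset\mathbb{R}^d,|C|=k}\sum_{x\in P}w(x)\min_{c\in C}\|x-c\|^2$. Ward's method starts with singleton clusters and repeatedly merges two current clusters minimizing $D(A,B)$; $\mathrm{Ward}_k(P)$ is the sum of $\Delta(Q,w)$ over the clusters $Q$ of the clustering obtained after $|P|-k$ merges. *)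

(* Defs.v *)
From HB Require Import structures.
From mathcomp Require Import all_boot all_order all_algebra finmap.
From mathcomp Require Import all_classical all_reals all_analysis.

Set Implicit Arguments.
Unset Strict Implicit.
Unset Printing Implicit Defensive.

Import Order.TTheory GRing.Theory Num.Theory.
Import numFieldNormedType.Exports.

Local Open Scope classical_set_scope.
Local Open Scope fset_scope.
Local Open Scope ring_scope.

(* Squared Euclidean distance; the library norm on ['rV[R]_d] is the sup norm. *)
Definition sqdist (R : realType) (d : nat) (x y : 'rV[R]_d) : R :=
  \sum_(i < d) (x ord0 i - y ord0 i) ^+ 2.

Definition weight (R : realType) (d : nat) (w : 'rV[R]_d -> nat)
    (Q : {fset 'rV[R]_d}) : R :=
  \sum_(x <- Q) (w x)%:R.

Definition centroid (R : realType) (d : nat) (w : 'rV[R]_d -> nat)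
    (Q : {fset 'rV[R]_d}) : 'rV[R]_d :=
  (weight w Q)^-1 *: \sum_(x <- Q) (w x)%:R *: x.

Definition Delta (R : realType) (d : nat) (w : 'rV[R]_d -> nat)
    (Q : {fset 'rV[R]_d}) : R :=
  \sum_(x <- Q) (w x)%:R * sqdist x (centroid w Q).

Definition merge_cost (R : realType) (d : nat) (w : 'rV[R]_d -> nat)
    (A B : {fset 'rV[R]_d}) : R :=
  Delta w (A `|` B) - Delta w A - Delta w B.

(* The infimum ranges over a finite set of values, so for nonempty [C] it is a
   minimum. *)
Definition centers_cost (R : realType) (d : nat) (w : 'rV[R]_d -> nat)
    (P C : {fset 'rV[R]_d}) : R :=
  \sum_(x <- P) (w x)%:R * inf [set sqdist x c | c in [set` C]].

(* [inf] renders the minimum over the [k]-point center sets; it is meaningful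
   only if [0 < k], and [k = 1] when [d = 0]. *)
Definition opt (R : realType) (d : nat) (w : 'rV[R]_d -> nat)
    (k : nat) (P : {fset 'rV[R]_d}) : R :=
  inf [set centers_cost w P C | C in [set C : {fset 'rV[R]_d} | #|` C| = k]].

(* [ward_run w P m C]: some run of Ward's method on [P] holds the clustering [C]
   after [m] merges.  Ties between minimizing pairs may be broken in any way. *)
Inductive ward_run (R : realType) (d : nat) (w : 'rV[R]_d -> nat)
    (P : {fset 'rV[R]_d}) : nat -> {fset {fset 'rV[R]_d}} -> Prop :=
| ward_start : ward_run w P 0 [fset [fset x] | x in P]
| ward_merge (m : nat) (C : {fset {fset 'rV[R]_d}}) (A B : {fset 'rV[R]_d}) :
    ward_run w P m C ->
    A \in C -> B \in C -> A != B ->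
    (forall A' B' : {fset 'rV[R]_d}, A' \in C -> B' \in C -> A' != B' ->
       merge_cost w A B <= merge_cost w A' B') ->
    ward_run w P m.+1 ((A `|` B) |` (C `\` [fset A; B])).

Definition ward_clustering (R : realType) (d : nat) (w : 'rV[R]_d -> nat)
    (k : nat) (P : {fset 'rV[R]_d}) (C : {fset {fset 'rV[R]_d}}) : Prop :=
  ward_run w P (#|` P| - k) C.

Definition clustering_cost (R : realType) (d : nat) (w : 'rV[R]_d -> nat)
    (C : {fset {fset 'rV[R]_d}}) : R :=
  \sum_(Q <- C) Delta w Q.

(* Main.v *)
(** The points come in pairs indexed by the vertices of a cube: a light point
    [light v] of weight 1 at a vertex of the box with half-sides [(3/2)^(l/2)],
    [l < d], and a heavy point [heavy v] of weight [3^d] at distance 2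
    from it, pushed outwards along the first axis.  The heavy points as centers
    show [opt <= 4 * 2^d].

    Ward's method however merges the light points face by face: a face spanned
    by the first [j] axes has weight [2^j], so merging two parallel adjacent
    ones along axis [j] costs [2^(j+1) (3/2)^j = 2 * 3^j].  The ratio 3/2 makes
    every other pair of light clusters at this stage more expensive, and the
    drift of the centroids towards the center keeps the heavy points, at squared
    distance at least [2 (3/2)^j + 2], just out of reach.  After [2^d - 1]
    merges all light points form one cluster, of cost [2^(d+1) ((3/2)^d - 1)],
    and a further merge cannot decrease the cost. *)

Require Import Defs.
From mathcomp Require Import all_boot all_order all_algebra finmap.
From mathcomp Require Import all_classical all_reals all_analysis.
From mathcomp Require Import ring lra.

Import Order.TTheory GRing.Theory Num.Theory.
Import numFieldNormedType.Exports.
Local Open Scope classical_set_scope.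
Local Open Scope fset_scope.
Local Open Scope ring_scope.

Set Implicit Arguments.
Unset Strict Implicit.

(** * Moments, centroids and the cost of merging two clusters *)

Section ClusterGeometry.
Context (R : realType) (d : nat) (w : 'rV[R]_d -> nat).
Implicit Types (x y c : 'rV[R]_d) (A B Q S : {fset 'rV[R]_d}).

Lemma sqdist_ge0 x y : 0 <= sqdist x y.
Proof. by apply: sumr_ge0 => i _; exact: sqr_ge0. Qed.

Lemma sqdistxx x : sqdist x x = 0.
Proof. by rewrite /sqdist big1 // => i _; rewrite subrr expr0n. Qed.

Lemma sqdistC x y : sqdist x y = sqdist y x.
Proof. by apply: eq_bigr => i _; rewrite -sqrrN opprB. Qed.

Lemma sqdist_ge_coord x y (i : 'I_d) :
  (x ord0 i - y ord0 i) ^+ 2 <= sqdist x y.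
Proof.
by rewrite /sqdist (bigD1 i) //= lerDl; apply: sumr_ge0 => j _; exact: sqr_ge0.
Qed.

(** In each coordinate the defect is the square of [x + y - 2 * c]. *)
Lemma sqdist_le_double x y c : sqdist x y <= 2 * (sqdist x c + sqdist y c).
Proof.
rewrite /sqdist -big_split mulr_sumr; apply: ler_sum => i _ /=.
have := sqr_ge0 (x ord0 i + y ord0 i - 2 * c ord0 i); nra.
Qed.

Lemma big_fsetU_disjoint A B (F : 'rV[R]_d -> R) : [disjoint A & B] ->
  \sum_(x <- A `|` B) F x = \sum_(x <- A) F x + \sum_(x <- B) F x.
Proof.
move=> AB; rewrite -big_cat; apply: perm_big; apply: uniq_perm.
- exact: fset_uniq.
- rewrite cat_uniq !fset_uniq /= andbT; apply/hasPn => x xB.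
  by apply/negP => xA; move/fdisjointP: AB => /(_ x xA); rewrite xB.
- by move=> x; rewrite mem_cat in_fsetU.
Qed.

Lemma weightU A B : [disjoint A & B] ->
  weight w (A `|` B) = weight w A + weight w B.
Proof. by move=> AB; rewrite /weight big_fsetU_disjoint. Qed.

Lemma Delta_ge0 Q : 0 <= Delta w Q.
Proof. by apply: sumr_ge0 => x _; rewrite mulr_ge0 ?sqdist_ge0. Qed.

Lemma weighted_coord_sum Q (i : 'I_d) : weight w Q != 0 ->
  \sum_(x <- Q) (w x)%:R * x ord0 i = weight w Q * centroid w Q ord0 i.
Proof.
move=> Q0; rewrite /centroid mxE mulrA divff // mul1r summxE.
by apply: eq_bigr => x _; rewrite mxE.
Qed.

(** The parallel axis theorem: the cross terms [2 * (m - c) * (x - m)] have weighted sum zero, as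
    [m] is the centroid. *)
Lemma moment_centroid Q c : weight w Q != 0 ->
  \sum_(x <- Q) (w x)%:R * sqdist x c =
  Delta w Q + weight w Q * sqdist (centroid w Q) c.
Proof.
move=> Q0; set m := centroid w Q.
have -> : weight w Q * sqdist m c = \sum_(x <- Q) (w x)%:R * sqdist m c.
  by rewrite mulr_suml.
rewrite /Delta -big_split /=; apply/eqP; rewrite -subr_eq0 -sumrB; apply/eqP.
under eq_bigr => x _.
  rewrite -mulrDr -mulrBr /sqdist -big_split -sumrB mulr_sumr /=.
  under eq_bigr => i _.
    rewrite (_ : (w x)%:R * _ = 2 * (m ord0 i - c ord0 i) *
      ((w x)%:R * x ord0 i) - 2 * (m ord0 i - c ord0 i) * m ord0 i * (w x)%:R);
      last by rewrite -/m; ring.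
    over.
  over.
rewrite exchange_big /= big1 // => i _; rewrite sumrB -!mulr_sumr.
by rewrite weighted_coord_sum // -/m -/(weight w Q); ring.
Qed.

(** By the parallel axis theorem the centroid of [S] minimizes the moment of [S]; measuring from the
    centroid of [Q] and adding the points outside [S] can only increase the sum. *)
Lemma Delta_sub S Q : weight w S != 0 -> {subset S <= Q} ->
  Delta w S <= Delta w Q.
Proof.
move=> S0 SQ; apply: le_trans
  (_ : \sum_(x <- S) (w x)%:R * sqdist x (centroid w Q) <= _).
  rewrite moment_centroid // lerDl mulr_ge0 ?sqdist_ge0 //.
  by apply: sumr_ge0.
have -> : Q = S `|` (Q `\` S).
  apply/fsetP => x; rewrite !inE; case: (boolP (x \in S)) => //= /SQ -> //.
rewrite /Delta big_fsetU_disjoint ?lerDl; last first.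
  by apply/fdisjointP => x xS; rewrite inE xS.
by apply: sumr_ge0 => x _; rewrite mulr_ge0 ?sqdist_ge0.
Qed.

Lemma centroidU A B : [disjoint A & B] -> 0 < weight w A -> 0 < weight w B ->
  centroid w (A `|` B) = (weight w A + weight w B)^-1 *:
    (weight w A *: centroid w A + weight w B *: centroid w B).
Proof.
move=> AB A0 B0; apply/rowP => i; rewrite !mxE weightU // summxE.
rewrite big_fsetU_disjoint // -!summxE; congr (_ * (_ + _)).
- by rewrite mulrA divff ?lt0r_neq0 ?mul1r.
- by rewrite mulrA divff ?lt0r_neq0 ?mul1r.
Qed.

(** Ward's formula: apply the parallel axis theorem to [A] and to [B] about the joint centroid; the
    two [Delta] terms cancel. *)
Lemma merge_costE A B : [disjoint A & B] ->
  0 < weight w A -> 0 < weight w B ->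
  merge_cost w A B = weight w A * weight w B / (weight w A + weight w B) *
    sqdist (centroid w A) (centroid w B).
Proof.
move=> AB A0 B0; rewrite /merge_cost {1}/Delta big_fsetU_disjoint //.
rewrite !moment_centroid ?lt0r_neq0 // centroidU //.
set a := weight w A in A0 *; set b := weight w B in B0 *.
have ab0 : a + b != 0 by rewrite lt0r_neq0 // addr_gt0.
rewrite [LHS](_ : _ = a * sqdist (centroid w A) ((a + b)^-1 *:
    (a *: centroid w A + b *: centroid w B)) + b * sqdist (centroid w B)
    ((a + b)^-1 *: (a *: centroid w A + b *: centroid w B))); last by ring.
clearbody a b; move: (centroid w A) (centroid w B) => p q.
rewrite /sqdist !mulr_sumr -big_split /=; apply: eq_bigr => i _.
by rewrite !mxE; field.
Qed.

Lemma merge_costC A B : merge_cost w A B = merge_cost w B A.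
Proof. by rewrite /merge_cost fsetUC addrAC. Qed.

Lemma weight1 x : weight w [fset x] = (w x)%:R.
Proof. by rewrite /weight big_seq_fset1. Qed.

Lemma centroid1 x : (0 < w x)%N -> centroid w [fset x] = x.
Proof.
move=> x0; rewrite /centroid weight1 big_seq_fset1 scalerA mulVf ?scale1r //.
by rewrite pnatr_eq0 -lt0n.
Qed.

Lemma Delta1 x : (0 < w x)%N -> Delta w [fset x] = 0.
Proof.
by move=> x0; rewrite /Delta big_seq_fset1 centroid1 // sqdistxx mulr0.
Qed.

End ClusterGeometry.

(** * Ward clusterings as partitions, and their number of clusters *)

Section Partition.
Context (T : choiceType).
Implicit Types (P Q : {fset T}) (C : {fset {fset T}}).

Definition is_fpartition P C :=
  [/\ forall Q, Q \in C -> Q != fset0,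
      forall A B, A \in C -> B \in C -> A != B -> [disjoint A & B] &
      forall x, x \in P <-> exists2 Q, Q \in C & x \in Q].

Lemma fpartition_block_eq P C A B x : is_fpartition P C ->
  A \in C -> B \in C -> x \in A -> x \in B -> A = B.
Proof.
case=> _ dis _ AC BC xA xB; apply/eqP; apply/negPn/negP => AB.
by have /fdisjointP/(_ x xA) := dis _ _ AC BC AB; rewrite xB.
Qed.

Lemma fpartition_singletons P : is_fpartition P [fset [fset x] | x in P].
Proof.
split=> [Q /imfsetP[x _ ->]|A B /imfsetP[x _ ->] /imfsetP[y _ ->] xy|x].
- by apply/fset0Pn; exists x; rewrite inE.
- rewrite fdisjoint1X inE; apply: contra xy => /eqP ->; exact: eqxx.
- split=> [xP|[Q /imfsetP[y /= yP ->]]]; last by rewrite inE => /eqP ->.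
  by exists [fset x]; rewrite ?inE //; apply/imfsetP; exists x.
Qed.

Lemma fpartition_merge P C A B : is_fpartition P C ->
  A \in C -> B \in C -> A != B ->
  is_fpartition P ((A `|` B) |` (C `\` [fset A; B])).
Proof.
move=> [ne dis cov] AC BC AB.
have disU Q : Q \in C `\` [fset A; B] -> [disjoint A `|` B & Q].
  rewrite !inE negb_or => /andP[/andP[QA QB] QC].
  by rewrite fdisjointUX !dis // eq_sym.
split=> [Q|Q Q'|x].
- rewrite inE => /orP[/fset1P ->|]; last by rewrite inE => /andP[_ /ne].
  have /fset0Pn[x xA] := ne _ AC.
  by apply/fset0Pn; exists x; rewrite inE xA.
- rewrite inE => /orP[/fset1P ->|QD]; rewrite inE => /orP[/fset1P ->|QD'].
  + by rewrite eqxx.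
  + by move=> _; exact: disU.
  + by move=> _; rewrite fdisjoint_sym; exact: disU.
  + by apply: dis; [move: QD | move: QD']; rewrite inE => /andP[].
- split=> [/cov[Q QC xQ]|[Q]].
    case: (boolP (Q \in [fset A; B])) => QAB.
      exists (A `|` B); first by rewrite !inE eqxx.
      by move: QAB xQ; rewrite !inE => /orP[] /eqP -> ->; rewrite ?orbT.
    by exists Q => //; rewrite in_fsetU in_fsetD QAB QC orbT.
  rewrite inE => /orP[/fset1P ->|].
    by rewrite inE => /orP[xA|xB]; apply/cov; [exists A|exists B].
  by rewrite inE => /andP[_ QC] xQ; apply/cov; exists Q.
Qed.

Lemma card_fpartition_merge P C A B : is_fpartition P C ->
  A \in C -> B \in C -> A != B ->
  #|` (A `|` B) |` (C `\` [fset A; B]) |.+1 = #|` C |.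
Proof.
move=> CP AC BC AB; have [ne dis _] := CP.
(* A block equal to the union would share a point of the nonempty [A] and so be [A] itself, which
   has been removed; hence the count drops by exactly one. *)
have UC : A `|` B \notin C `\` [fset A; B].
  rewrite !inE negb_and negbK; apply/orP.
  case: (boolP (A `|` B \in C)) => UC; last by right.
  have /fset0Pn[x xA] := ne _ AC; have /fset0Pn[y yB] := ne _ BC.
  by left; rewrite (@fpartition_block_eq P C (A `|` B) A x) ?eqxx ?inE ?xA.
have sub : [fset A; B] `<=` C by apply/fsubsetP => Q; rewrite !inE => /orP[] /eqP ->.
by rewrite cardfsU1 UC -(cardfsID [fset A; B] C) (fsetIidPr sub) cardfs2 AB.
Qed.

End Partition.

Lemma ward_run_partition (R : realType) (d : nat) (w : 'rV[R]_d -> nat)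
    (P : {fset 'rV[R]_d}) m (C : {fset {fset 'rV[R]_d}}) :
  ward_run w P m C -> is_fpartition P C /\ (#|` C | + m)%N = #|` P |.
Proof.
elim=> [|{}m {}C A B _ [CP cardC] AC BC AB _].
  split; first exact: fpartition_singletons.
  by rewrite addn0 card_imfset //; exact: fset1_inj.
split; first exact: fpartition_merge.
by rewrite addnS -addSn (card_fpartition_merge CP).
Qed.

(** * The point set and its distances *)

Section Cube.
Context (R : realType) (d : nat).
Implicit Types (u v : {ffun 'I_d -> bool}) (j : nat) (l : 'I_d).

Definition side (k : nat) : R := Num.sqrt ((3 / 2) ^+ k).

(** The value 3 is [side 0 + 2], which puts each heavy point at distance 2 from its light
    partner. *)
Definition heavy_side (k : nat) : R := if k == 0%N then 3 else side k.

(** Light points, heavy points and box centroids are all corners for different [s], so the distance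
    bounds below are shared. *)
Definition corner (s : nat -> R) v : 'rV[R]_d :=
  \row_l ((-1) ^+ (v l) * s l).

Definition light := corner side.
Definition heavy := corner heavy_side.

(* The centroid of [box j v] below. *)
Definition box_center j := corner (fun k => if (k < j)%N then 0 else side k).

Definition lights : {fset 'rV[R]_d} :=
  [fset light v | v in {ffun 'I_d -> bool}].
Definition heavies : {fset 'rV[R]_d} :=
  [fset heavy v | v in {ffun 'I_d -> bool}].
Definition cube_points := lights `|` heavies.
(** In dimension 0 the light and the heavy point coincide, whence the hypothesis [0 < d] wherever
    the two kinds are told apart. *)
Definition cube_weight (x : 'rV[R]_d) : nat :=
  if x \in heavies then (3 ^ d)%N else 1%N.

Definition agree_from j u v := [forall l : 'I_d, (j <= l)%N ==> (u l == v l)].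

(** The face through [light v] spanned by the first [j] axes; any of its vertices may serve as
    [v]. *)
Definition box j v : {fset 'rV[R]_d} :=
  [fset light u | u in [pred u | agree_from j u v]].

Definition flip j v : {ffun 'I_d -> bool} :=
  [ffun l : 'I_d => if l == j :> nat then ~~ v l else v l].

Lemma side_gt0 k : 0 < side k.
Proof. by rewrite sqrtr_gt0 exprn_gt0 // divr_gt0. Qed.

Lemma side_sq k : side k ^+ 2 = (3 / 2) ^+ k.
Proof. by rewrite sqr_sqrtr // exprn_ge0 // divr_ge0. Qed.

Lemma side_ge1 k : 1 <= side k.
Proof.
rewrite -[leLHS]sqrtr1 ler_sqrt ?exprn_gt0 ?divr_gt0 //.
by apply: exprn_ege1; lra.
Qed.

Lemma side0 : side 0 = 1.
Proof. by rewrite /side expr0 sqrtr1. Qed.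

Lemma heavy_side_ge1 k : 1 <= heavy_side k.
Proof. by rewrite /heavy_side; case: eqP => _; [lra | exact: side_ge1]. Qed.

Lemma corner_inj s : (forall k, 0 < s k) -> injective (corner s).
Proof.
move=> s0 u v /rowP uv; apply/ffunP => l; have := uv l; rewrite !mxE.
move/(mulIf (lt0r_neq0 (s0 l))) => /eqP; rewrite -subr_eq0.
by case: (u l); case: (v l) => //=; rewrite ?expr0 ?expr1 => /eqP; lra.
Qed.

Lemma light_inj : injective light.
Proof. by apply: corner_inj => l; exact: side_gt0. Qed.

Lemma heavy_inj : injective heavy.
Proof.
by apply: corner_inj => l; apply: lt_le_trans (heavy_side_ge1 l); lra.
Qed.

Lemma ffun_neqP u v : u != v -> exists l, u l != v l.
Proof.
move=> uv; apply/existsP; apply: contraNT uv; rewrite negb_exists => /forallP uv.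
by apply/eqP/ffunP => l; apply/eqP; rewrite -[_ == _]negbK uv.
Qed.

Lemma sqdist_corner_neq (s t : nat -> R) u v l : u l != v l ->
  (s l + t l) ^+ 2 <= sqdist (corner s u) (corner t v).
Proof.
move=> uv; apply: le_trans (sqdist_ge_coord _ _ l); rewrite !mxE.
by move: uv; case: (u l); case: (v l) => //= _; rewrite ?expr0 ?expr1; nra.
Qed.

Lemma sqdist_corner_ge (s t : nat -> R) u v l : 0 <= s l -> 0 <= t l ->
  (s l - t l) ^+ 2 <= sqdist (corner s u) (corner t v).
Proof.
move=> s0 t0; apply: le_trans (sqdist_ge_coord _ _ l); rewrite !mxE.
by case: (u l); case: (v l); rewrite /= ?expr0 ?expr1; nra.
Qed.

Lemma sqdist_light_ge4 u v : u != v -> 4 <= sqdist (light u) (light v).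
Proof.
case/ffun_neqP => l /(sqdist_corner_neq side side); apply: le_trans.
by have := side_ge1 l; nra.
Qed.

Lemma sqdist_heavy_ge4 u v : u != v -> 4 <= sqdist (heavy u) (heavy v).
Proof.
case/ffun_neqP => l /(sqdist_corner_neq heavy_side heavy_side); apply: le_trans.
by have := heavy_side_ge1 l; nra.
Qed.

Lemma sqdist_light_heavy_ge4 u v : (0 < d)%N ->
  4 <= sqdist (light u) (heavy v).
Proof.
(* On the first axis the coordinates have absolute values 1 and 3. *)
move=> d0; have := @sqdist_corner_ge side heavy_side u v (Ordinal d0).
by rewrite /heavy_side /= side0 => /(_ ler01 (ler0n _ _)); lra.
Qed.

Lemma sqdist_light_heavy_le4 v : sqdist (light v) (heavy v) <= 4.
Proof.
have F l : (light v ord0 l - heavy v ord0 l) ^+ 2 = if l == 0%N :> nat then 4 else 0.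
  rewrite !mxE -mulrBr exprMn sqrr_sign mul1r /heavy_side.
  by case: eqP => [->|_]; rewrite ?side0 ?subrr; ring.
rewrite /sqdist (eq_bigr _ (fun l _ => F l)).
have [l0|/pred0P l0] := pickP (fun l : 'I_d => l == 0%N :> nat).
  move=> /= l00; rewrite (bigD1 l0) //= l00 big1 ?addr0 // => l /negPf ll.
  case: eqP => // /= l_0; move: ll; case/eqP: l00 => l00.
  by rewrite -val_eqE /= l_0 l00.
rewrite big1 // => l _; by move/pred0P: l0 => ->.
Qed.

(** On an axis not yet averaged out, both centers keep the coordinate [side l] up to sign. *)
Lemma sqdist_box_center_ge j j' u v l : (j <= l)%N -> (j' <= l)%N ->
  u l != v l -> 4 * (3 / 2) ^+ l <= sqdist (box_center j u) (box_center j' v).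
Proof.
move=> jl jl' uv; apply: le_trans (sqdist_corner_neq _ _ uv).
by rewrite -side_sq !ltnNge jl jl' /=; lra.
Qed.

Lemma sqdist_box_center_flip v l :
  sqdist (box_center l v) (box_center l (flip l v)) = 4 * (3 / 2) ^+ l.
Proof.
rewrite /sqdist (bigD1 l) //= big1 ?addr0 => [|l' ll'].
  rewrite !mxE ltnn ffunE eqxx -side_sq.
  by case: (v l); rewrite /= ?expr0 ?expr1; ring.
rewrite !mxE ffunE (_ : (l' == l :> nat) = false) ?subrr ?expr0n //.
exact: negbTE.
Qed.

Lemma sum_side_sq j : \sum_(l < j) (3 / 2) ^+ l = 2 * ((3 / 2) ^+ j - 1) :> R.
Proof.
elim: j => [|j IH]; first by rewrite big_ord0 expr0; ring.
by rewrite big_ord_recr /= IH exprS; field.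
Qed.

Lemma sqdist_heavy_box_center_ge j u v : (0 < d)%N -> (j <= d)%N ->
  2 * (3 / 2) ^+ j + 2 <= sqdist (heavy u) (box_center j v).
Proof.
(* For [j = 0] the center is a light point and the bound is the squared distance 4. *)
move=> d0 jd; case: j jd => [_|j jd].
  have := @sqdist_light_heavy_ge4 v u d0; rewrite sqdistC expr0.
  by congr (_ <= _); lra.
(* The center vanishes on the first [j.+1] axes, so these contribute the squares of the heavy sides.
   The first is 9 = 8 + 1, and the geometric sum gives [2 * (3 / 2) ^+ j.+1 + 6]. *)
apply: (@le_trans _ _ (\sum_(l < j.+1) heavy_side l ^+ 2)).
  apply: (@le_trans _ _ (8 + \sum_(l < j.+1) (3 / 2) ^+ l)).
    by rewrite sum_side_sq; lra.
  rewrite !big_ord_recl /= expr0 addrA lerD //.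
    by rewrite /heavy_side /=; lra.
  by apply: ler_sum => l _; rewrite /heavy_side /= side_sq.
rewrite (big_ord_widen d (fun k => heavy_side k ^+ 2) jd).
rewrite /sqdist big_mkcond /=; apply: ler_sum => l _; rewrite !mxE.
case: ifP => lj; last exact: sqr_ge0.
by rewrite mulr0 subr0 exprMn sqrr_sign mul1r.
Qed.

End Cube.

(** * Weights, centroids and costs of the boxes *)

Section Boxes.
Context (R : realType) (d : nat).
Implicit Types (u v : {ffun 'I_d -> bool}) (j : nat) (l : 'I_d).

Local Notation light := (@light R d).
Local Notation heavy := (@heavy R d).
Local Notation box := (@box R d).
Local Notation w := (@cube_weight R d).

Lemma agree_fromP j u v :
  reflect (forall l, (j <= l)%N -> u l = v l) (agree_from j u v).
Proof.
apply: (iffP forallP) => uv l; first by move=> jl; apply/eqP/(implyP (uv l)).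
by apply/implyP => /uv ->.
Qed.

Lemma mem_lights v : light v \in lights R d.
Proof. by apply/imfsetP; exists v. Qed.

Lemma mem_heavies v : heavy v \in heavies R d.
Proof. by apply/imfsetP; exists v. Qed.

Lemma light_in_box j u v : (light u \in box j v) = agree_from j u v.
Proof.
apply/imfsetP/idP => [[u' /= uv' /light_inj -> //]|uv]; by exists u.
Qed.

Lemma box_in_lights j v x : x \in box j v ->
  exists2 u, x = light u & agree_from j u v.
Proof. by case/imfsetP => u /= uv ->; exists u. Qed.

Lemma box_refl j v : light v \in box j v.
Proof. by rewrite light_in_box; apply/agree_fromP. Qed.

Lemma eq_box j u v : agree_from j u v -> box j u = box j v.
Proof.
move/agree_fromP => uv; apply/fsetP => x; apply/idP/idP.
- case/box_in_lights => u' -> /agree_fromP uu; rewrite light_in_box.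
  by apply/agree_fromP => l jl; rewrite uu ?uv.
- case/box_in_lights => u' -> /agree_fromP uu; rewrite light_in_box.
  by apply/agree_fromP => l jl; rewrite uu ?uv.
Qed.

Lemma box0 v : box 0 v = [fset light v].
Proof.
apply/fsetP => x; rewrite inE; apply/idP/eqP => [|->]; last exact: box_refl.
case/box_in_lights => u -> /agree_fromP uv; congr light.
by apply/ffunP => l; apply: uv.
Qed.

Lemma box_full j v : (d <= j)%N -> box j v = lights R d.
Proof.
move=> dj; apply/fsetP => x; apply/idP/imfsetP => [|[u _ ->]].
  by case/box_in_lights => u ->; exists u.
rewrite light_in_box; apply/agree_fromP => l jl.
by have := leq_trans dj jl; rewrite leqNgt ltn_ord.
Qed.

(** The face splits along axis [l] into the half containing [light v] and the opposite half. *)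
Lemma boxS l v : box l.+1 v = box l v `|` box l (flip l v).
Proof.
apply/fsetP => x; rewrite in_fsetU; apply/idP/orP.
- case/box_in_lights => u -> /agree_fromP uv; rewrite !light_in_box.
  case: (eqVneq (u l) (v l)) => uvl; [left|right]; apply/agree_fromP => l'.
    by rewrite leq_eqVlt => /orP[/eqP/val_inj <- //|/uv].
  rewrite ffunE leq_eqVlt eq_sym => /orP[ll|ll'].
    by rewrite ll (val_inj (eqP ll)); move: uvl; case: (u l); case: (v l).
  by rewrite gtn_eqF // uv.
- case=> /box_in_lights[u -> /agree_fromP uv]; rewrite light_in_box;
    apply/agree_fromP => l' ll'; rewrite uv ?(ltnW ll') //.
  by rewrite ffunE gtn_eqF.
Qed.

Lemma box_flip_disjoint l v : [disjoint box l v & box l (flip l v)].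
Proof.
apply/fdisjointP => x /box_in_lights[u -> /agree_fromP uv].
rewrite light_in_box; apply/negP => /agree_fromP/(_ l (leqnn l)).
by rewrite uv // ffunE eqxx; case: (v l).
Qed.

Lemma weight_heavy v : w (heavy v) = (3 ^ d)%N.
Proof. by rewrite /cube_weight mem_heavies. Qed.

Lemma light_neq_heavy u v : (0 < d)%N -> light u != heavy v.
Proof.
move=> d0; apply/eqP => uv; have := sqdist_light_heavy_ge4 R u v d0.
by rewrite uv sqdistxx; lra.
Qed.

Lemma light_notin_heavies u : (0 < d)%N -> light u \notin heavies R d.
Proof.
by move=> d0; apply/imfsetP => -[v _ /eqP]; apply/negP/light_neq_heavy.
Qed.

Lemma weight_light v : (0 < d)%N -> w (light v) = 1%N.
Proof. by move=> d0; rewrite /cube_weight (negPf (light_notin_heavies v d0)). Qed.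

Lemma cube_weight_gt0 x : (0 < w x)%N.
Proof. by rewrite /cube_weight; case: ifP => _ //; rewrite expn_gt0. Qed.

(** The two halves have equal weight, so averaging their centers cancels coordinate [j] and keeps
    the others. *)
Lemma box_weight_centroid j v : (0 < d)%N -> (j <= d)%N ->
  weight w (box j v) = 2 ^+ j /\ centroid w (box j v) = box_center R j v.
Proof.
move=> d0; elim: j v => [|j IH] v jd.
  rewrite box0 weight1 centroid1 ?cube_weight_gt0 // weight_light //; split=> //.
have wt v' := (IH v' (ltnW jd)).1; have ct v' := (IH v' (ltnW jd)).2.
have j2 : 0 < 2 ^+ j :> R by rewrite exprn_gt0.
have := boxS (Ordinal jd) v; have := box_flip_disjoint (Ordinal jd) v.
move=> /= dis ->; rewrite weightU // !wt; split; first by rewrite exprS; ring.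
rewrite centroidU ?wt // !ct; apply/rowP => l; rewrite !mxE ffunE /=.
rewrite (ltnS l j) (leq_eqVlt l j).
case: (eqVneq (l : nat) j) => [->|lj] /=.
  by rewrite ltnn; case: (v l); rewrite /= ?expr0 ?expr1; ring.
by case: ltnP => _; field; rewrite lt0r_neq0 // addr_gt0.
Qed.

(** This cost is the threshold that every other pair must exceed at stage [l]. *)
Lemma merge_cost_flip l v :
  merge_cost w (box l v) (box l (flip l v)) = 2 * 3 ^+ l.
Proof.
have d0 : (0 < d)%N := leq_ltn_trans (leq0n l) (ltn_ord l).
have [wv cv] := box_weight_centroid v d0 (ltnW (ltn_ord l)).
have [wu cu] := box_weight_centroid (flip l v) d0 (ltnW (ltn_ord l)).
have p2 : 0 < 2 ^+ l :> R by rewrite exprn_gt0.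
rewrite merge_costE ?wv ?wu ?box_flip_disjoint // cv cu sqdist_box_center_flip.
by rewrite expr_div_n; field; rewrite !lt0r_neq0 // addr_gt0.
Qed.

(** Solves the recurrence in which the cost doubles and grows by [2 * 3 ^+ j]. *)
Lemma Delta_box j v : (0 < d)%N -> (j <= d)%N ->
  Delta w (box j v) = 2 ^+ j * (2 * ((3 / 2) ^+ j - 1)).
Proof.
move=> d0; elim: j v => [|j IH] v jd.
  by rewrite box0 Delta1 ?cube_weight_gt0 // !expr0; ring.
have := merge_cost_flip (Ordinal jd) v; rewrite /merge_cost -boxS /= !IH ?(ltnW jd) //.
rewrite -addrA -opprD => /eqP; rewrite subr_eq => /eqP ->.
have -> : 3 ^+ j = 2 ^+ j * (3 / 2) ^+ j :> R by rewrite -exprMn; congr (_ ^+ _); field.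
by rewrite !exprS; field.
Qed.

End Boxes.

(** * The course of Ward's method on the cube *)

Section WardOnCube.
Context (R : realType) (d : nat) (d_gt0 : (0 < d)%N).
Implicit Types (u v : {ffun 'I_d -> bool}) (j : nat) (l : 'I_d).
Implicit Types (C : {fset {fset 'rV[R]_d}}).

Local Notation light := (@light R d).
Local Notation heavy := (@heavy R d).
Local Notation lights := (lights R d).
Local Notation heavies := (heavies R d).
Local Notation box := (@box R d).
Local Notation P := (cube_points R d).
Local Notation w := (@cube_weight R d).

(** The right side increases in [p] and [q], and equals [m / 2] at [p = q = m]. *)
Lemma half_le_harmonic (m p q : R) : 0 < m -> m <= p -> m <= q ->
  m / 2 <= p * q / (p + q).
Proof. by move=> m0 mp mq; rewrite ler_pdivlMr ?addr_gt0; nra. Qed.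

Lemma merge_cost_boxes_gt i j j' u v l : (i <= j <= d)%N -> (i <= j' <= d)%N ->
  (j <= l)%N -> (j' <= l)%N -> (i < l)%N -> u l != v l ->
  2 * 3 ^+ i < merge_cost w (box j u) (box j' v).
Proof.
move=> /andP[ij jd] /andP[ij' jd'] jl jl' il uv.
have [wu cu] := box_weight_centroid R u d_gt0 jd.
have [wv cv] := box_weight_centroid R v d_gt0 jd'.
have e0 (k : nat) : 0 < 2 ^+ k :> R by rewrite exprn_gt0.
have dis : [disjoint box j u & box j' v].
  apply/fdisjointP => x /box_in_lights[u' -> /agree_fromP uu].
  rewrite light_in_box; apply/negP => /agree_fromP/(_ l jl') uv'.
  by move: uv; rewrite -uv' uu ?eqxx.
rewrite merge_costE ?wu ?wv // cu cv.
(* The weight factor is at least [2 ^+ i / 2], and the centers differ on an axis beyond [i]; the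
   product is [3 * 3 ^+ i]. *)
apply: (@lt_le_trans _ _ (2 ^+ i / 2 * (4 * (3 / 2) ^+ i.+1))).
  have -> : 3 ^+ i = 2 ^+ i * (3 / 2) ^+ i :> R.
    by rewrite -exprMn; congr (_ ^+ _); field.
  have : 0 < 2 ^+ i * (3 / 2) ^+ i :> R by rewrite mulr_gt0 // exprn_gt0 // divr_gt0.
  by rewrite [(3 / 2) ^+ i.+1]exprS; lra.
apply: ler_pM; rewrite ?mulr_ge0 ?exprn_ge0 ?invr_ge0 //.
  by apply: half_le_harmonic => //; apply: ler_weXn2l => //; lra.
apply: le_trans (sqdist_box_center_ge R jl jl' uv).
by rewrite ler_pM2l //; apply: ler_weXn2l => //; lra.
Qed.

Lemma merge_cost_heavies_gt i u v : (i < d)%N -> u != v ->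
  2 * 3 ^+ i < merge_cost w [fset heavy u] [fset heavy v].
Proof.
move=> id uv; have e0 : 0 < 3 ^+ d :> R by rewrite exprn_gt0.
have dis : [disjoint [fset heavy u] & [fset heavy v]].
  by rewrite fdisjoint1X inE (inj_eq (@heavy_inj R d)).
rewrite merge_costE ?weight1 ?centroid1 ?ltr0n ?cube_weight_gt0 //.
rewrite !weight_heavy natrX.
have ei : 3 ^+ i < 3 ^+ d :> R by rewrite ltr_eXn2l //; lra.
apply: (@lt_le_trans _ _ (3 ^+ d / 2 * 4)); first lra.
by apply: ler_pM; rewrite ?sqdist_heavy_ge4 ?divr_ge0 ?exprn_ge0 ?half_le_harmonic.
Qed.

Lemma merge_cost_heavy_box_gt i j u v : (i <= j)%N -> (j <= d)%N -> (i < d)%N ->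
  2 * 3 ^+ i < merge_cost w [fset heavy u] (box j v).
Proof.
move=> ij jd id; have [wv cv] := box_weight_centroid R v d_gt0 jd.
have dis : [disjoint [fset heavy u] & box j v].
  rewrite fdisjoint1X; apply/negP => /box_in_lights[u' /eqP + _].
  by rewrite eq_sym; apply/negP/light_neq_heavy.
have W0 : 0 < 3 ^+ d :> R by rewrite exprn_gt0.
have j0 : 0 < 2 ^+ j :> R by rewrite exprn_gt0.
have i0 : 0 < 3 ^+ i :> R by rewrite exprn_gt0.
rewrite merge_costE ?weight1 ?centroid1 ?ltr0n ?cube_weight_gt0 ?wv ?cv //.
rewrite weight_heavy natrX.
have eW : 3 ^+ i < 3 ^+ d :> R by rewrite ltr_eXn2l //; lra.
have ej : 3 ^+ i <= 3 ^+ j :> R by rewrite ler_weXn2l //; lra.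
apply: (@lt_le_trans _ _ (3 ^+ d * 2 ^+ j / (3 ^+ d + 2 ^+ j) *
    (2 * (3 / 2) ^+ j + 2))); last first.
  by rewrite ler_pM2l ?sqdist_heavy_box_center_ge // divr_gt0 ?mulr_gt0 ?addr_gt0.
rewrite mulrAC ltr_pdivlMr ?addr_gt0 //.
(* After clearing the denominator, [2 * 3 ^+ i * 3 ^+ d] is paid by the main part of the distance
   and [2 * 3 ^+ i * 2 ^+ j] by its summand 2. *)
have -> : 3 ^+ d * 2 ^+ j * (2 * (3 / 2) ^+ j + 2) =
    2 * (3 ^+ d * 3 ^+ j) + 2 * (3 ^+ d * 2 ^+ j) :> R.
  by rewrite expr_div_n; field; rewrite lt0r_neq0.
have : 3 ^+ i * 3 ^+ d <= 3 ^+ d * 3 ^+ j :> R by rewrite mulrC ler_pM2l.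
have : 3 ^+ i * 2 ^+ j < 3 ^+ d * 2 ^+ j :> R by rewrite ltr_pM2r.
nra.
Qed.

(** Stage [i]: light boxes of level [i] are being paired into boxes of level [i.+1]. *)
Definition at_level i C := forall Q, Q \in C ->
  (exists v, Q = [fset heavy v]) \/ (exists v, Q = box i v \/ Q = box i.+1 v).

Definition lights_merged C := forall Q, Q \in C ->
  (exists v, Q = [fset heavy v]) \/ Q = lights.

Lemma cheap_pair_siblings l C A B : is_fpartition P C -> at_level l C ->
  A \in C -> B \in C -> A != B -> merge_cost w A B <= 2 * 3 ^+ l ->
  exists v, A = box l v /\ B = box l (flip l v).
Proof.
move=> CP lev AC BC AB cost.
have ld := ltn_ord l.
have costF : ~ 2 * 3 ^+ l < merge_cost w A B by rewrite ltNge cost.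
have boxE Q : (exists v, Q = box l v \/ Q = box l.+1 v) ->
    exists j v, [/\ (l <= j)%N, (j <= l.+1)%N & Q = box j v].
  by case=> v [->|->]; [exists (l : nat)|exists l.+1]; exists v; split.
case: (lev _ AC) (lev _ BC) => [[u Au]|/boxE[j [u [lj jl Au]]]]
    [[v Bv]|/boxE[j' [v [lj' jl' Bv]]]].
- case: costF; rewrite Au Bv; apply: merge_cost_heavies_gt => //.
  by apply: contraNneq AB => uv; rewrite Au Bv uv.
- case: costF; rewrite Au Bv.
  by apply: merge_cost_heavy_box_gt => //; apply: leq_trans jl' _.
- case: costF; rewrite Au Bv merge_costC.
  by apply: merge_cost_heavy_box_gt => //; apply: leq_trans jl _.
- have uv : agree_from l.+1 u v.
    apply/agree_fromP => l' ll'; apply/eqP/negPn/negP => uvl'; apply: costF.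
    rewrite Au Bv; apply: (merge_cost_boxes_gt (l := l')) => //.
    + by rewrite lj (leq_trans jl).
    + by rewrite lj' (leq_trans jl').
    + exact: leq_trans jl ll'.
    + exact: leq_trans jl' ll'.
  have notboth x : x \in A -> x \in B -> False.
    by move=> xA xB; case/eqP: AB; apply: fpartition_block_eq CP AC BC xA xB.
  have vu : agree_from l.+1 v u.
    by apply/agree_fromP => l' /(agree_fromP _ _ _ uv) ->.
  (* A box of level [l.+1] agreeing with the other from [l.+1] on would contain a vertex of that
     other, disjoint box. *)
  have {}jl : j = l.
    move: jl; rewrite leq_eqVlt ltnS => /orP[/eqP jl|jl]; last first.
      by apply/eqP; rewrite eqn_leq jl.
    by case: (notboth (light v)); rewrite ?Bv ?box_refl // Au jl light_in_box.
  have {}jl' : j' = l.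
    move: jl'; rewrite leq_eqVlt ltnS => /orP[/eqP jl'|jl']; last first.
      by apply/eqP; rewrite eqn_leq jl'.
    by case: (notboth (light u)); rewrite ?Au ?box_refl // Bv jl' light_in_box.
  exists u; rewrite Au jl; split=> //; rewrite Bv jl'; apply: eq_box.
  apply/agree_fromP => l'; rewrite ffunE leq_eqVlt eq_sym => /orP[ll|ll'].
    rewrite ll (val_inj (eqP ll)); case: (eqVneq (v l) (u l)) => [vul|].
      case: (notboth (light u)); first by rewrite Au box_refl.
      rewrite Bv jl' light_in_box; apply/agree_fromP => l''.
      rewrite leq_eqVlt => /orP[/eqP/val_inj <- //|].
      exact: (agree_fromP _ _ _ uv).
    by case: (v l); case: (u l).
  by rewrite gtn_eqF // (agree_fromP _ _ _ vu).
Qed.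

(** A box of level [l.+1] holding the flipped vertex would also hold [light v], so it would be
    [box l v] itself, which misses the flipped vertex. *)
Lemma box_sibling_mem l v C : is_fpartition P C -> at_level l C ->
  box l v \in C -> box l (flip l v) \in C.
Proof.
move=> CP lev vC; have [_ _ cov] := CP.
have [Q QC] : exists2 Q, Q \in C & light (flip l v) \in Q.
  by apply/cov; rewrite inE mem_lights.
case: (lev _ QC) => [[u ->]|[u [Qu|Qu]]].
- by rewrite inE (negPf (light_neq_heavy _ _ _ d_gt0)).
- by rewrite Qu light_in_box => /eq_box ->; rewrite -Qu.
- rewrite Qu light_in_box => /agree_fromP fu.
  have vQ : light v \in Q.
    rewrite Qu light_in_box; apply/agree_fromP => l' ll'.
    by rewrite -fu // ffunE gtn_eqF.
  have Qv := fpartition_block_eq CP QC vC vQ (box_refl _ _ _).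
  have fQ : light (flip l v) \in Q by rewrite Qu light_in_box; apply/agree_fromP.
  have /fdisjointP/(_ (light (flip l v))) := box_flip_disjoint R l v.
  by rewrite -Qv fQ box_refl => /(_ isT).
Qed.

Lemma at_level_merge l v C : at_level l C ->
  at_level l ((box l v `|` box l (flip l v)) |`
    (C `\` [fset box l v; box l (flip l v)])).
Proof.
move=> lev Q; rewrite inE => /orP[/fset1P ->|]; last first.
  by rewrite inE => /andP[_]; exact: lev.
by right; exists v; right; rewrite boxS.
Qed.

Definition light_level C :=
  (exists l, at_level l C /\ exists v, box l v \in C) \/ lights_merged C.

(** When no box of level [l] is left, the next stage begins; past the last axis the only box is
    [lights]. *)
Lemma at_level_light_level l C : is_fpartition P C -> at_level l C ->
  light_level C.
Proof.
move=> CP lev; case: (boolP [exists v, box l v \in C]) => [/existsP exv|].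
  by left; exists l.
rewrite negb_exists => /forallP nov.
have lev' Q : Q \in C ->
    (exists v, Q = [fset heavy v]) \/ exists v, Q = box l.+1 v.
  move=> QC; case: (lev _ QC) => [|[v [Qv|Qv]]]; [by left| |by right; exists v].
  by move: (nov v); rewrite -Qv QC.
case: (ltnP l.+1 d) => ld; last first.
  by right=> Q /lev'[|[v ->]]; [left|right; exact: box_full].
left; exists (Ordinal ld); split.
  by move=> Q /lev'[|[v ->]]; [left|right; exists v; left].
have [_ _ cov] := CP; pose v0 := [ffun _ : 'I_d => true].
have [Q QC] : exists2 Q, Q \in C & light v0 \in Q.
  by apply/cov; rewrite inE mem_lights.
case: (lev' _ QC) => [[u ->]|[u Qu _]].
  by rewrite inE (negPf (light_neq_heavy _ _ _ d_gt0)).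
by exists u; rewrite -Qu.
Qed.

Lemma card_heavies : #|` heavies | = (2 ^ d)%N.
Proof.
rewrite card_imfset /=; last exact: heavy_inj.
by rewrite -cardE card_ffun card_bool card_ord.
Qed.

Lemma card_cube_points : #|` P | = (2 ^ d + 2 ^ d)%N.
Proof.
have dis : [disjoint lights & heavies].
  by apply/fdisjointP => x /imfsetP[u _ ->]; exact: light_notin_heavies.
rewrite cardfsU (eqP (dis : _ == _)) cardfs0 subn0 card_heavies; congr addn.
rewrite card_imfset /=; last exact: light_inj.
by rewrite -cardE card_ffun card_bool card_ord.
Qed.

Lemma card_heavy_singletons : #|` [fset [fset x] | x in heavies] | = (2 ^ d)%N.
Proof. by rewrite card_imfset ?card_heavies //; exact: fset1_inj. Qed.

Lemma card_lights_merged C : lights_merged C -> (#|` C | <= (2 ^ d).+1)%N.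
Proof.
move=> mer; have /fsubset_leq_card :
    C `<=` lights |` [fset [fset x] | x in heavies].
  apply/fsubsetP => Q /mer[[v ->]|->]; rewrite !inE ?eqxx //.
  by apply/orP; right; apply/imfsetP; exists (heavy v) => //=; exact: mem_heavies.
move/leq_trans; apply; rewrite cardfsU1 card_heavy_singletons.
by rewrite -[leqRHS]add1n leq_add2r leq_b1.
Qed.

(** An unfinished stage has two sibling boxes besides all [2 ^ d] heavy singletons. *)
Lemma card_at_level l v C : is_fpartition P C -> at_level l C ->
  box l v \in C -> ((2 ^ d).+2 <= #|` C |)%N.
Proof.
move=> CP lev vC; have fC := box_sibling_mem CP lev vC.
have boxH j u : box j u \notin [fset [fset x] | x in heavies].
  apply/imfsetP => -[x /imfsetP[u' _ ->] /fsetP/(_ (light u))].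
  by rewrite box_refl inE (negPf (light_neq_heavy _ _ _ d_gt0)).
have bf : box l v != box l (flip l v).
  apply/eqP => bf; have /fdisjointP/(_ (light v)) := box_flip_disjoint R l v.
  by rewrite -bf box_refl => /(_ isT).
have <- : #|` box l v |` (box l (flip l v) |`
    [fset [fset x] | x in heavies])| = (2 ^ d).+2.
  by rewrite !cardfsU1 !inE negb_or bf !boxH card_heavy_singletons.
apply: fsubset_leq_card; apply/fsubsetP => Q; rewrite !inE.
case/or3P => [/eqP -> //|/eqP -> //|/imfsetP[x /imfsetP[u _ ->] ->]].
have [_ _ cov] := CP.
have [Q' QC] : exists2 Q, Q \in C & heavy u \in Q.
  by apply/cov; rewrite inE mem_heavies orbT.
have noBox j u' : heavy u \notin box j u'.
  apply/negP => /box_in_lights[u'' /eqP + _].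
  by rewrite eq_sym; apply/negP/light_neq_heavy.
case: (lev _ QC) => [[u' Qu]|[u' [->|->]]]; rewrite ?(negPf (noBox _ _)) //.
by move: QC; rewrite Qu inE => + /eqP ->.
Qed.

Lemma ward_light_level m C : ward_run w P m C -> (m < 2 ^ d)%N -> light_level C.
Proof.
move=> run; elim: run => [|{}m {}C A B run IH AC BC AB minAB] md.
  have CP := fpartition_singletons P.
  apply: (@at_level_light_level (Ordinal d_gt0)) => // Q /imfsetP[x /=].
  rewrite inE => /orP[/imfsetP[v _ ->]|/imfsetP[v _ ->]] ->; last by left; exists v.
  by right; exists v; left; rewrite box0.
have [CP cardC] := ward_run_partition run.
(* If the light points were already merged, there would be at most [2 ^ d + 1] clusters, too few for
   [m.+1 < 2 ^ d]. *)
case: (IH (ltnW md)) => [[l [lev [v vC]]]|mer]; last first.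
  have := card_lights_merged mer; rewrite -(leq_add2r m) cardC card_cube_points.
  by rewrite addSn -addnS leq_add2l leqNgt md.
have fC := box_sibling_mem CP lev vC.
have vf : box l v != box l (flip l v).
  apply/eqP => bf; have /fdisjointP/(_ (light v)) := box_flip_disjoint R l v.
  by rewrite -bf box_refl => /(_ isT).
(* The siblings are an available pair, so the chosen pair costs no more than the threshold. *)
have := minAB _ _ vC fC vf; rewrite merge_cost_flip // => cheap.
have [u [Au Bu]] := cheap_pair_siblings CP lev AC BC AB cheap.
apply: (@at_level_light_level l); first exact: fpartition_merge.
by rewrite Au Bu; exact: at_level_merge.
Qed.

(** Exactly [2 ^ d + 1] clusters are left, which rules out an unfinished stage. *)
Lemma ward_lights_mem m C : ward_run w P m C -> m.+1 = (2 ^ d)%N ->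
  lights \in C.
Proof.
move=> run md; have [CP cardC] := ward_run_partition run.
have cC : #|` C | = (2 ^ d).+1.
  by apply/eqP; rewrite -(eqn_add2r m) cardC card_cube_points addSn -addnS md.
have : (m < 2 ^ d)%N by rewrite -md.
case/(ward_light_level run) => [[l [lev [v vC]]]|mer].
  by have := card_at_level CP lev vC; rewrite cC ltnn.
have [_ _ cov] := CP; pose v0 := [ffun _ : 'I_d => true].
have [Q QC] : exists2 Q, Q \in C & light v0 \in Q.
  by apply/cov; rewrite inE mem_lights.
case: (mer _ QC) => [[u ->]|<- //].
by rewrite inE (negPf (light_neq_heavy _ _ _ d_gt0)).
Qed.

Lemma ward_lights_sub C : ward_clustering w (2 ^ d) P C ->
  exists2 Q, Q \in C & lights `<=` Q.
Proof.
rewrite /ward_clustering card_cube_points addnK.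
have [n nE] : exists n, n = (2 ^ d)%N by exists (2 ^ d)%N.
rewrite -nE => run; case: run nE => [/esym/eqP|m {}C A B run AC BC AB _ md].
  by rewrite expn_eq0.
have LC := ward_lights_mem run md.
(* The last of the [2 ^ d] merges may absorb [lights], so only containment survives. *)
case: (boolP (lights \in [fset A; B])) => LAB.
  exists (A `|` B); first by rewrite !inE eqxx.
  by move: LAB; rewrite !inE => /orP[] /eqP ->; rewrite ?fsubsetUl ?fsubsetUr.
by exists lights => //; rewrite in_fsetU in_fsetD LAB LC orbT.
Qed.

Lemma weight_lights_Delta :
  weight w lights != 0 /\ Delta w lights = 2 ^+ d * (2 * ((3 / 2) ^+ d - 1)).
Proof.
pose v0 := [ffun _ : 'I_d => true]; rewrite -(box_full R v0 (leqnn d)).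
split; last exact: Delta_box.
by have [-> _] := box_weight_centroid R v0 d_gt0 (leqnn d); rewrite expf_neq0.
Qed.

Lemma ward_cost_ge C : ward_clustering w (2 ^ d) P C ->
  2 ^+ d * (2 * ((3 / 2) ^+ d - 1)) <= clustering_cost w C.
Proof.
case/ward_lights_sub => Q QC /fsubsetP sub.
have [L0 <-] := weight_lights_Delta.
apply: le_trans (Delta_sub L0 sub) _.
rewrite /clustering_cost (big_fsetD1 Q) //= lerDl.
by apply: sumr_ge0 => Q' _; exact: Delta_ge0.
Qed.

End WardOnCube.

(** * General bounds on the optimal cost *)

Section Optimum.
Context (R : realType) (d : nat).
Implicit Types (P C : {fset 'rV[R]_d}) (w : 'rV[R]_d -> nat).

Lemma inf_sqdist_ge0 x C : 0 <= inf [set sqdist x c | c in [set` C]].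
Proof.
(* The infimum of the empty set is 0 by convention. *)
have [->|/set0P ne] := eqVneq [set sqdist x c | c in [set` C]] set0.
  by rewrite inf0.
by apply: lb_le_inf => // _ [c _ <-]; exact: sqdist_ge0.
Qed.

Lemma inf_sqdist_le x C c : c \in C ->
  inf [set sqdist x c | c in [set` C]] <= sqdist x c.
Proof.
move=> cC; apply: ge_inf; last by exists c.
by exists 0 => _ [c' _ <-]; exact: sqdist_ge0.
Qed.

Lemma inf_sqdist_attained x C : C != fset0 ->
  exists2 c, c \in C & inf [set sqdist x c | c in [set` C]] = sqdist x c.
Proof.
case/fset0Pn => c0 c0C; pose c1 : C := [` c0C].
case: (arg_minP (fun c : C => sqdist x (val c)) (erefl true : xpredT c1)) => c _ cmin.
exists (val c); first exact: valP.
apply/eqP; rewrite eq_le inf_sqdist_le ?(valP c) //=.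
apply: lb_le_inf; first by exists (sqdist x c0), c0.
by move=> _ [c' c'C <-]; exact: (cmin [` c'C] isT).
Qed.

Lemma centers_cost_ge0 w P C : 0 <= centers_cost w P C.
Proof. by apply: sumr_ge0 => x _; rewrite mulr_ge0 ?inf_sqdist_ge0. Qed.

Lemma opt_le w k P C : #|` C | = k -> opt w k P <= centers_cost w P C.
Proof.
move=> Ck; apply: ge_inf; last by exists C.
by exists 0 => _ [C' _ <-]; exact: centers_cost_ge0.
Qed.

(* Two of the points share their nearest center. *)
Lemma centers_cost_ge w P C e : C != fset0 -> (#|` C | < #|` P |)%N ->
  (forall x, x \in P -> (0 < w x)%N) ->
  (forall x y, x \in P -> y \in P -> x != y -> e <= sqdist x y) ->
  e / 2 <= centers_cost w P C.
Proof.
move=> C0 CP w0 sep.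
have /choice[f fP] x : exists c, c \in C /\
    inf [set sqdist x c | c in [set` C]] = sqdist x c.
  by have [c cC cE] := inf_sqdist_attained x C0; exists c.
have /card_in_imfsetP inj : #|` f @` P | != #|` P |.
  rewrite ltn_eqF // (leq_ltn_trans _ CP) //; apply: fsubset_leq_card.
  by apply/fsubsetP => _ /imfsetP[x _ ->]; exact: (fP x).1.
have [x [y [xP yP xy fxy]]] :
    exists x y, [/\ x \in P, y \in P, x != y & f x = f y].
  apply: contrapT => no; apply: inj => x y xP yP fxy; apply/eqP/negPn/negP => xy.
  by apply: no; exists x, y.
have le1 z : z \in P ->
    sqdist z (f z) <= (w z)%:R * inf [set sqdist z c | c in [set` C]].
  move=> zP; rewrite (fP z).2 ler_peMl ?sqdist_ge0 //.
  by rewrite ler1n w0.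
rewrite /centers_cost (big_fsetD1 x) //= (big_fsetD1 y) /=; last first.
  by rewrite !inE eq_sym xy.
(* The separation [e] is at most twice the total squared distance to the common center. *)
apply: (@le_trans _ _ (sqdist x (f x) + sqdist y (f y))).
  have := sep _ _ xP yP xy; have := sqdist_le_double x y (f x).
  by rewrite -fxy; lra.
rewrite addrA -[leLHS]addr0 !lerD ?le1 //.
by apply: sumr_ge0 => z _; rewrite mulr_ge0 ?inf_sqdist_ge0.
Qed.

End Optimum.

(** * The optimal cost of the cube instance *)

Section CubeOptimum.
Context (R : realType) (d : nat) (d_gt0 : (0 < d)%N).
Local Notation P := (cube_points R d).
Local Notation w := (@cube_weight R d).

Lemma cube_points_separated x y : x \in P -> y \in P -> x != y ->
  4 <= sqdist x y.
Proof.
rewrite !inE => /orP[] /imfsetP[u _ ->] /orP[] /imfsetP[v _ ->] xy.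
- by apply: sqdist_light_ge4; apply: contraNneq xy => ->.
- exact: sqdist_light_heavy_ge4.
- by rewrite sqdistC; exact: sqdist_light_heavy_ge4.
- by apply: sqdist_heavy_ge4; apply: contraNneq xy => ->.
Qed.

Lemma cube_opt_ge2 : 2 <= opt w (2 ^ d) P.
Proof.
apply: lb_le_inf => [|_ [C /= Ck <-]].
  (* The heavy points witness that the infimum is over a nonempty set. *)
  by exists (centers_cost w P (heavies R d)), (heavies R d) => //=; exact: card_heavies.
have -> : 2 = 4 / 2 :> R by field.
apply: centers_cost_ge.
- by rewrite -cardfs_gt0 Ck expn_gt0.
- by rewrite Ck card_cube_points // -[ltnLHS]addn0 ltn_add2l expn_gt0.
- by move=> x _; exact: cube_weight_gt0.
- exact: cube_points_separated.
Qed.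

Lemma cube_opt_le : opt w (2 ^ d) P <= 4 * 2 ^+ d.
Proof.
apply: le_trans (opt_le w P (card_heavies R d)) _.
have dis : [disjoint lights R d & heavies R d].
  by apply/fdisjointP => x /imfsetP[u _ ->]; exact: light_notin_heavies.
rewrite /centers_cost big_fsetU_disjoint //.
(* Heavy points are their own centers and cost nothing. *)
rewrite [X in _ + X]big1_seq ?addr0 => [|x /= xH]; last first.
  have := inf_sqdist_le x xH; rewrite sqdistxx => le0.
  by rewrite [X in _ * X](_ : _ = 0) ?mulr0 //; apply/le_anti; rewrite le0 inf_sqdist_ge0.
rewrite big_imfset /=; last by move=> u v _ _; exact: light_inj.
apply: (@le_trans _ _ (\sum_(v <- enum {ffun 'I_d -> bool}) 4)).
  apply: ler_sum => v _; rewrite weight_light // mul1r.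
  by apply: le_trans (inf_sqdist_le _ (mem_heavies R v)) (sqdist_light_heavy_le4 R v).
rewrite big_const_seq count_predT -cardE card_ffun card_bool card_ord iter_addr_0.
by rewrite -[_ *+ (2 ^ d)]mulr_natr natrX.
Qed.

End CubeOptimum.


Theorem theorem22 (R : realType) :
  exists (P : forall d : nat, {fset 'rV[R]_d})
         (w : forall d : nat, 'rV[R]_d -> nat),
    (forall (d : nat) (x : 'rV[R]_d), x \in P d -> (0 < w d x)%N) /\
    (forall d : nat, (0 < d)%N -> 0 < opt (w d) (2 ^ d) (P d)) /\
    (forall C : forall d : nat, {fset {fset 'rV[R]_d}},
       (forall d : nat, ward_clustering (w d) (2 ^ d) (P d) (C d)) ->
       (fun d : nat => clustering_cost (w d) (C d) : R^o) \is
         'Omega_\oo (fun d : nat =>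
           (3 / 2) ^+ d * opt (w d) (2 ^ d) (P d) : R^o)).
Proof.
exists (fun d => cube_points R d), (fun d => @cube_weight R d).
split; first by move=> d x _; exact: cube_weight_gt0.
split=> [d d0|C ward].
  by apply: lt_le_trans (cube_opt_ge2 R d0); lra.
(* With [q = (3 / 2) ^+ d >= 3 / 2] we have [q - 1 >= q / 3], so the cost is at least
   [(2 / 3) * 2 ^+ d * q]; as [opt <= 4 * 2 ^+ d], this yields 1/6. *)
rewrite qualifE; apply/asboolP; exists (1 / 6); first lra.
(* At [d = 0] the lower bound on the cost degenerates to 0. *)
exists 1%N => // d /= d0.
have cost := ward_cost_ge d0 (ward d).
have opt4 := cube_opt_le R d0.
have opt2 := cube_opt_ge2 R d0.
have q1 : 3 / 2 <= (3 / 2) ^+ d :> R by apply: ler_eXnr => //; lra.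
have p0 : 0 < 2 ^+ d :> R by rewrite exprn_gt0.
rewrite ger0_norm; last by rewrite mulr_ge0 //; lra.
rewrite ger0_norm; last by apply: le_trans cost; rewrite mulr_ge0 //; lra.
apply: le_trans cost; nra.
Qed.
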